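(* Neither of the parameters $\alpha_{\mathrm{bnr}}$ and $\Gamma_b$ is an upper bound for the other, and neither of the parameters $\alpha_{\mathrm{bn}}$ and $\Gamma_b$ is an upper bound for the other. That is, there exist graphs $G_1,G_2,G_3,G_4$ such that $\alpha_{\mathrm{bnr}}(G_1)>\Gamma_b(G_1)$, $\Gamma_b(G_2)>\alpha_{\mathrm{bnr}}(G_2)$, $\alpha_{\mathrm{bn}}(G_3)>\Gamma_b(G_3)$ and $\Gamma_b(G_4)>\alpha_{\mathrm{bn}}(G_4)$.
   Context: All graphs are finite and simple. Let $d(u,v)$ denote distance and $e(v)$ the eccentricity of $v$. A broadcast on a connected graph $G=(V,E)$ is a function $f:V\to\{0,1,\dots,\operatorname{diam}(G)\}$ with $f(v)\le e(v)$ for all $v\in V$ if $|V|\ge 2$, and $f(v)=1$ if $V=\{v\}$. On a disconnected graph, a broadcast is a union of broadcasts on its components. Let $V_f^+=\{v: f(v)>0\}$ and $\sigma(f)=\sum_{v\in V}f(v)$ (the weight). A vertex $u$ hears $f$ from $v\in V_f^+$ (and $v$ dominates $u$) if $d(u,v)\le f(v)$. $f$ is dominating if every vertex hears $f$ from some vertex of $V_f^+$. A dominating broadcast $f$ is minimal dominating if no broadcast $g\neq f$ with $g(v)\le f(v)$ for all $v$ is dominating. $\Gamma_b(G)$ is the maximum weight of a minimal dominating broadcast of $G$. For $v\in V_f^+$ let $N_f(v)=\{u:d(u,v)\le f(v)\}$, $B_f(v)=\{u:d(u,v)=f(v)\}$, and let the private boundary $\operatorname{PB}_f(v)$ be the set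 of $u\in N_f(v)$ that are not dominated by the function obtained from $f$ by changing the value at $v$ to $f(v)-1$. $f$ is irredundant if $\operatorname{PB}_f(v)\ne\varnothing$ for each $v\in V_f^+$. $f$ is bn-independent if $N_f(u)\cap N_f(v)\subseteq B_f(u)\cap B_f(v)$ for all distinct $u,v\in V_f^+$; it is bnr-independent if it is bn-independent and irredundant. $\alpha_{\mathrm{bn}}(G)$ and $\alpha_{\mathrm{bnr}}(G)$ are the maximum weights of a bn-independent and a bnr-independent broadcast on $G$, respectively. *)

(* Defs.v *)
From mathcomp Require Import all_boot.

Set Implicit Arguments.
Unset Strict Implicit.
Unset Printing Implicit Defensive.

Record sgraph := SGraph {
  vertex :> finType;
  edge : rel vertex;
  edge_sym : symmetric edge;
  edge_irrefl : irreflexive edge }.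

Section Broadcast.
Variable G : sgraph.
Implicit Types (u v : G) (f : G -> nat) (k : nat).

Definition component v : {set G} := [set u | connect (@edge G) v u].

Definition walk k u v : bool :=
  [exists p : k.-tuple G, path (@edge G) u p && (last u p == v)].

(* The length of a shortest walk from u to v; between distinct components the
   value is the junk #|G|, so every use below is restricted to a component. *)
Definition dist u v : nat := find (fun k => walk k u v) (iota 0 #|G|).

Definition ecc v : nat := \max_(u in component v) dist v u.

(* Inside a component of order at least 2, the bound f v <= diam of that
   component is implied by f v <= ecc v. *)
Definition broadcast f : bool :=
  [forall v, if #|component v| == 1 then f v == 1 else f v <= ecc v].

Definition weight f : nat := \sum_v f v.

Definition positive f : {set G} := [set v | 0 < f v].

Definition nbhd f v : {set G} := [set u in component v | dist u v <= f v].

Definition boundary f v : {set G} := [set u in component v | dist u v == f v].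

Definition dominated f u : bool := [exists v in positive f, u \in nbhd f v].

Definition dominating f : bool := [forall u, dominated f u].

Definition decrease f v : G -> nat := fun u => if u == v then (f v).-1 else f u.

Definition private_boundary f v : {set G} :=
  [set u in nbhd f v | ~~ dominated (decrease f v) u].

Definition irredundant f : bool :=
  [forall v in positive f, private_boundary f v != set0].

Definition bn_independent f : bool :=
  [forall u in positive f, forall v in positive f, (u != v) ==>
     (nbhd f u :&: nbhd f v \subset boundary f u :&: boundary f v)].

Definition bnr_independent f : bool := bn_independent f && irredundant f.

(* A finite type through which every broadcast factors (lemma broadcast_factor),
   so that one can quantify and take maxima over all broadcasts. *)
Definition bfun : Type := {ffun G -> 'I_#|G|.+1}.

Definition bval (f : bfun) : G -> nat := fun v => val (fun_of_fin f v).
Coercion bval : bfun >-> Funclass.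

Definition minimal_dominating (f : bfun) : bool :=
  [&& broadcast f, dominating f
    & [forall g : bfun, [&& broadcast g, g != f & [forall v, g v <= f v]]
         ==> ~~ dominating g]].

(* The sets of broadcasts maximised over are never empty (lemmas
   minimal_dominating_ex and bnr_independent_ex), so the default value 0
   of \max plays no role. *)
Definition Gamma_b : nat := \max_(f : bfun | minimal_dominating f) weight f.

Definition alpha_bn : nat :=
  \max_(f : bfun | broadcast f && bn_independent f) weight f.

Definition alpha_bnr : nat :=
  \max_(f : bfun | broadcast f && bnr_independent f) weight f.

Lemma dist_le_card u v : dist u v <= #|G|.
Proof. by rewrite -[X in _ <= X](size_iota 0) find_size. Qed.

Lemma connect_walk u v :
  connect (@edge G) u v -> exists2 k, k < #|G| & walk k u v.
Proof.
case/connectP => p pP ->; case/shortenP: pP => p' p'P Up' _.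
exists (size p').
  by have := max_card [in u :: p']; rewrite (card_uniqP Up').
by apply/existsP; exists (in_tuple p'); rewrite p'P eqxx.
Qed.

Lemma walk_connect k u v : walk k u v -> connect (@edge G) u v.
Proof.
case/existsP => p /andP[pP /eqP <-].
by apply/connectP; exists p.
Qed.

Lemma dist_walk u v : connect (@edge G) u v -> walk (dist u v) u v.
Proof.
case/connect_walk => k kn kw.
have hs : has (fun j => walk j u v) (iota 0 #|G|).
  by apply/hasP; exists k => //; rewrite mem_iota.
have := nth_find 0 hs; rewrite nth_iota //.
by move: hs; rewrite has_find size_iota.
Qed.

Lemma dist_min k u v : walk k u v -> dist u v <= k.
Proof.
move=> kw; rewrite leqNgt; apply/negP => lt.
have := before_find 0 lt; rewrite nth_iota ?kw //.
exact: leq_trans lt (dist_le_card u v).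
Qed.

Lemma ecc_le_card v : ecc v <= #|G|.
Proof. by apply/bigmax_leqP => u _; apply: dist_le_card. Qed.

Lemma broadcast_le f v : broadcast f -> f v <= #|G|.
Proof.
move/forallP/(_ v); case: ifP => _.
  by move/eqP->; apply/card_gt0P; exists v.
by move/leq_trans; apply; apply: ecc_le_card.
Qed.

Lemma dist_gt0 u v : u != v -> 0 < dist u v.
Proof.
move=> uv; have n0 : 0 < #|G| by apply/card_gt0P; exists u.
rewrite /dist -(prednK n0) /=; case: ifP => // /existsP[p].
by rewrite (tuple0 p) /= (negPf uv).
Qed.

Lemma ecc_gt0 v : #|component v| != 1 -> 0 < ecc v.
Proof.
have vC : v \in component v by rewrite inE connect0.
rewrite (cardsD1 v) vC add1n eqSS cards_eq0 => /set0Pn[u].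
rewrite !inE => /andP[uv cvu].
apply: leq_trans (_ : dist v u <= _); first by rewrite dist_gt0 // eq_sym.
by apply: leq_bigmax_cond; rewrite inE.
Qed.

Lemma dist_self v : dist v v = 0.
Proof.
apply/eqP; rewrite -leqn0; apply: dist_min.
by apply/existsP; exists [tuple]; rewrite /= eqxx.
Qed.

Lemma broadcast_factor f : broadcast f -> exists g : bfun, g =1 f.
Proof.
move=> bf; exists [ffun v => inord (f v)] => v.
by rewrite /bval ffunE /= inordK // ltnS broadcast_le.
Qed.

Lemma weight_lt (f g : bfun) :
  g != f -> (forall v, g v <= f v) -> weight g < weight f.
Proof.
move=> gf le; rewrite ltn_neqAle leq_sum ?andbT //.
apply: contra gf => /eqP eqw; apply/eqP/ffunP => v; apply/val_inj/eqP.
rewrite eqn_leq; apply/andP; split; first exact: (le v).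
rewrite leqNgt; apply/negP => lt; suff: weight g < weight f by rewrite eqw ltnn.
rewrite /weight (bigD1 v) //= [X in _ < X](bigD1 v) //= -addSn.
by rewrite leq_add // leq_sum.
Qed.

Lemma minimal_dominating_ex : exists f : bfun, minimal_dominating f.
Proof.
have b1 : broadcast (fun _ : G => 1).
  by apply/forallP => v; case: ifP => // /negbT /ecc_gt0.
have [f0 f0E] := broadcast_factor b1.
have P0 : broadcast f0 && dominating f0.
  apply/andP; split.
    by apply/forallP => v; rewrite !f0E; apply: (forallP b1).
  apply/forallP => v; apply/existsP; exists v.
  by rewrite !inE f0E connect0 dist_self.
case: (@arg_minnP bfun f0 (fun f : bfun => broadcast f && dominating f)
         (fun f : bfun => weight f) P0) => f /andP[bf df] fmin.
exists f; apply/and3P; split=> //; apply/forallP => g.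
apply/implyP => /and3P[bg gf /forallP le]; apply/negP => dg.
by have := fmin g; rewrite bg dg leqNgt weight_lt // => /(_ isT).
Qed.

Lemma bnr_independent_ex :
  exists f : bfun, broadcast f && bnr_independent f.
Proof.
have bI : broadcast (fun v : G => #|component v| == 1 : nat).
  by apply/forallP => v; case: (_ == 1).
have [f fE] := broadcast_factor bI.
have fP v : v \in positive f -> component v = [set v].
  rewrite inE fE; case: eqP => // /eqP/cards1P[x xE] _.
  have : v \in component v by rewrite inE connect0.
  by rewrite xE inE => /eqP <-.
have nP v : nbhd f v \subset component v.
  by apply/subsetP => u; rewrite inE => /andP[].
exists f; apply/and3P; split.
- by apply/forallP => v; have := forallP bI v; rewrite !fE.
- apply/forallP => u; apply/implyP => pu; apply/forallP => v.
  apply/implyP => pv; apply/implyP => uv; apply/subsetP => x.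
  rewrite inE => /andP[/(subsetP (nP _)) + /(subsetP (nP _))].
  by rewrite !fP // !inE => /eqP -> /eqP uv'; rewrite uv' eqxx in uv.
apply/forallP => v; apply/implyP => pv; apply/set0Pn; exists v.
rewrite inE; apply/andP; split; first by rewrite !inE connect0 dist_self.
apply/existsP => -[w /andP[pw vw]].
have le1 : f w <= 1 by rewrite fE leq_b1.
have pw' : w \in positive f.
  move: pw; rewrite !inE /decrease; case: eqP => [->|] //.
  by move/leq_trans; apply; apply: leq_pred.
have : v \in component w by have := vw; rewrite inE => /andP[].
rewrite fP // inE => /eqP vE; move: pw.
by rewrite inE /decrease vE eqxx ltn_predRL ltnNge le1.
Qed.

End Broadcast.

(* Main.v *)
Require Import Defs.
From HB Require Import structures.
From mathcomp Require Import all_boot.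
From mathcomp Require Import zify.

(** Since [alpha_bnr_le_bn] compares the two independence parameters, two graphs
    suffice: one with [alpha_bn < Gamma_b] and one with [Gamma_b < alpha_bnr].

    The first is the prism over a triangle.  Its diameter is 2, which leaves
    [alpha_bn] at most 2, while the three vertices of one triangle form a minimal
    dominating set.

    The second exploits that a bnr-independent broadcast need not be dominating.
    It has nine vertices: two paths of length 2 ending in the leaves [A'] and
    [B'] start at a hub [H], which carries a third leaf [T]; the private vertices
    [P] and [Q] of the values 2 at [A'] and [B'] are adjacent to a further vertex
    [R].  The values 2, 2, 1 at [A'], [B'], [T] have weight 5 and leave [R]
    undominated, and any way to dominate [R] is expensive: it takes the private
    vertex away from [A'] or [B'].  That no minimal dominating broadcast reaches
    weight 5 follows from two facts.  Every positive vertex [y] has a private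
    vertex [z], and [f y] is the distance from [z] to [y], or 1
    ([minimal_irredundant], [private_dist]); and once a value [f x] is large, few
    vertices remain that can be private to anything else
    ([weight_le_uncovered]). *)

Set Implicit Arguments.
Unset Strict Implicit.
Unset Printing Implicit Defensive.

(** * Distances and broadcasts on an arbitrary graph *)

Section General.
Variable G : sgraph.
Implicit Types (u v w x y z : G) (f : G -> nat).

Lemma mem_component u v : (v \in component u) = connect (@edge G) u v.
Proof. by rewrite inE. Qed.

Lemma component_sym u v : (v \in component u) = (u \in component v).
Proof. by rewrite !inE; apply/sym_connect_sym/edge_sym. Qed.

Lemma self_nbhd f v : v \in nbhd f v.
Proof. by rewrite !inE connect0 dist_self. Qed.

Lemma walk_rcons k u v w : walk k u v -> edge v w -> walk k.+1 u w.
Proof.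
case/existsP=> p /andP[pP /eqP pv] vw; apply/existsP.
by exists [tuple of rcons p w]; rewrite rcons_path last_rcons pP pv vw eqxx.
Qed.

Lemma walk0 u : walk 0 u u.
Proof. by apply/existsP; exists [tuple]; rewrite /= eqxx. Qed.

Lemma dist_edge u v : edge u v -> dist u v <= 1.
Proof. by move=> uv; apply/dist_min/walk_rcons/uv/walk0. Qed.

Lemma walk1_edge u v : walk 1 u v -> edge u v.
Proof.
by case/existsP=> [[[|x [|? ?]]]] //= ?; rewrite andbT => /andP[ux /eqP <-].
Qed.

Lemma dist_le1 u v :
  v \in component u -> dist u v <= 1 -> u = v \/ edge u v.
Proof.
rewrite mem_component => /dist_walk.
case: (dist u v) => [|[|]] //; last by move/walk1_edge; right.
by case/existsP=> p /=; rewrite (tuple0 p) /= => /eqP; left.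
Qed.

(** [dist] is a search through tuples and cannot be evaluated on a concrete
    graph.  The three conditions below are local and can be
    checked by computation, and they force [D] to be the distance: stepping back along [Dpred]
    produces a walk of length [D x y], and [Dlip] forbids a shorter one. *)
Section DistanceTable.
Variable D : G -> G -> nat.
Hypothesis D0 : forall x y, (D x y == 0) = (x == y).
Hypothesis Dlip : forall x y z, edge y z -> D x z <= (D x y).+1.
Hypothesis Dpred :
  forall x y, 0 < D x y -> exists2 z, edge z y & D x y = (D x z).+1.

Lemma table_walk x y : walk (D x y) x y.
Proof.
move dE: (D x y) => d; elim: d y dE => [|d IHd] y dE.
  by move/eqP: dE; rewrite D0 => /eqP <-; apply: walk0.
have [|z zy] := @Dpred x y; rewrite dE // => -[dz].
exact: walk_rcons (IHd z (esym dz)) zy.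
Qed.

Lemma table_component x : component x = setT.
Proof.
by apply/setP=> y; rewrite mem_component inE (walk_connect (table_walk x y)).
Qed.

Lemma table_dist x y : dist x y = D x y.
Proof.
apply/eqP; rewrite eqn_leq dist_min ?table_walk //=.
have /dist_walk : connect (@edge G) x y by apply: walk_connect (table_walk x y).
case/existsP=> -[p /= /eqP <-] /andP[pP /eqP <-].
elim/last_ind: p pP => [|p z IHp] /=; first by rewrite leqn0 D0.
rewrite rcons_path last_rcons size_rcons => /andP[pP pz].
by rewrite (leq_trans (Dlip x pz)) // ltnS IHp.
Qed.

End DistanceTable.

Lemma private_other f v w u :
  u \in private_boundary f v -> w \in positive f -> w != v -> u \notin nbhd f w.
Proof.
rewrite !inE => /andP[_ undom] pw wv; apply: contra undom => uw.
by apply/existsP; exists w; rewrite !inE /decrease (negPf wv) pw.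
Qed.

(** A private vertex [u] of [v] is lost when [f v] drops by one.  So [u] is at
    distance exactly [f v], except that [f v = 1] also allows [u = v], because
    a broadcast of value 0 does not reach its own vertex. *)
Lemma private_dist f v u :
  v \in positive f -> u \in private_boundary f v -> f v = maxn 1 (dist u v).
Proof.
rewrite !inE => pv /andP[/andP[cu du] undom].
have: ~~ ((0 < (f v).-1) && (dist u v <= (f v).-1)).
  apply: contra undom => small; apply/existsP; exists v; rewrite !inE /decrease eqxx cu.
  exact: small.
move: pv du; lia.
Qed.

(** If [v] had no private vertex, then decreasing [f] by one at [v] would give a
    smaller dominating function.  That function is a broadcast unless [v] is an
    isolated vertex; there [f v = 1] is forced and [v] is its own private
    vertex. *)
Lemma minimal_irredundant (f : bfun G) : minimal_dominating f -> irredundant f.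
Proof.
case/and3P=> bf df /forallP fmin.
apply/forallP=> v; apply/implyP=> pv; apply/set0Pn.
have fv := forallP bf v; have pv' := pv; rewrite inE in pv'.
case: ifP fv => [comp1 /eqP fv1 | ncomp1 fv].
  exists v; rewrite inE self_nbhd /=; apply/existsP=> -[w /andP[pw vw]].
  have: v \in component w by move: vw; rewrite inE => /andP[].
  rewrite component_sym; case/cards1P: comp1 => x cvE.
  have: v \in component v by rewrite inE connect0.
  rewrite cvE !inE => /eqP <- /eqP wv; move: pw.
  by rewrite inE /decrease wv eqxx fv1.
have bg : broadcast (decrease f v).
  apply/forallP=> w; rewrite /decrease.
  have [->|_] := eqVneq w v; last exact: (forallP bf w).
  by rewrite ncomp1 (leq_trans (leq_pred _) fv).
have [g gE] := broadcast_factor bg.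
have /implyP := fmin g; rewrite negb_forall => /(_ _)/existsP[|u ndu].
  apply/and3P; split.
  - by apply/forallP=> w; have := forallP bg w; rewrite !gE.
  - apply: contraL pv' => /eqP gf; have := gE v.
    by rewrite gf /decrease eqxx; lia.
  - by apply/forallP=> w; rewrite gE /decrease; case: eqP => [->|//]; lia.
have ndu' : ~~ dominated (decrease f v) u.
  apply: contra ndu => /existsP[w hw]; apply/existsP; exists w.
  by move: hw; rewrite !inE !gE.
exists u; rewrite inE ndu' andbT.
have /existsP[w /andP[pw uw]] := forallP df u.
have [-> //|wv] := eqVneq v w.
case/negP: ndu'; apply/existsP; exists w; move: pw uw.
by rewrite !inE /decrease eq_sym (negPf wv) => -> ->.
Qed.

(** Choosing a private vertex for each positive vertex is injective, and the
    vertices other than [x] choose among those that do not hear [x].  Hence at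
    most [size s] vertices besides [x] are positive.  The bound [k] is only
    asked for vertices with a private vertex in [s], which through
    [private_dist] turns it into a condition on distances. *)
Lemma weight_le_uncovered f x k (s : seq G) :
    irredundant f -> x \in positive f ->
    (forall z, z \notin nbhd f x -> z \in s) ->
    (forall y z, y != x -> y \in positive f -> z \in private_boundary f y ->
       z \in s -> f y <= k) ->
  weight f <= f x + k * size s.
Proof.
move=> irr px xs fk; pose pi y := odflt x [pick z in private_boundary f y].
have piP y : y \in positive f -> pi y \in private_boundary f y.
  move=> py; rewrite /pi; case: pickP => //= none.
  have /implyP/(_ py)/set0Pn[z] := forallP irr y.
  by rewrite [_ \in _]none.
have pis y : y != x -> y \in positive f -> pi y \in s.
  by move=> yx py; apply/xs/(private_other (piP y py)); rewrite // eq_sym.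
rewrite /weight (bigD1 x) //= leq_add2l.
rewrite (bigID (mem (positive f))) /= addnC big1 => [|y]; last first.
  by case/andP=> _; rewrite inE lt0n negbK => /eqP.
pose A := [set y in positive f | y != x].
apply: (@leq_trans (\sum_(y in A) k)).
  rewrite (eq_bigl (fun y => y \in A)) => [|y]; last by rewrite !inE andbC.
  apply: leq_sum => y; rewrite inE => /andP[py yx].
  exact: (fk y (pi y)) (piP y py) (pis y yx py).
rewrite sum_nat_const mulnC leq_mul2l; apply/orP; right.
have pi_inj : {in A &, injective pi}.
  move=> y w; rewrite !inE => /andP[py _] /andP[pw _] eqpi; apply/eqP/negPn.
  apply/negP=> yw.
  have := private_other (piP w (_ : w \in positive f)) (_ : y \in positive f) yw.
  rewrite !inE => /(_ pw py); rewrite -eqpi.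
  have : pi y \in private_boundary f y by apply: piP; rewrite inE.
  by rewrite !inE => /andP[->].
rewrite -(card_in_imset pi_inj) (leq_trans _ (card_size s)) //.
apply/subset_leq_card/subsetP=> z /imsetP[y]; rewrite inE => /andP[py yx] ->.
exact: pis.
Qed.

(** A positive vertex is at distance 0 from itself, so it is never on its own
    boundary. *)
Lemma bn_far f u v :
  bn_independent f -> u \in positive f -> v \in positive f -> u != v ->
  u \notin nbhd f v.
Proof.
move=> bn pu pv uv; apply/negP=> uNv.
have /implyP/(_ pu)/forallP/(_ v)/implyP/(_ pv)/implyP/(_ uv) := forallP bn u.
move/subsetP/(_ u); rewrite inE self_nbhd uNv => /(_ isT).
by move: pu; rewrite !inE dist_self => fu /andP[/andP[_ /eqP f0]]; rewrite -f0 in fu.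
Qed.

End General.

Lemma alpha_bnr_le_bn (G : sgraph) : alpha_bnr G <= alpha_bn G.
Proof.
apply/bigmax_leqP=> f /and3P[bf bn _].
by apply: (@leq_bigmax_cond _ _ (fun f : bfun G => weight f)); rewrite bf.
Qed.

(** * The prism over a triangle *)

Section Prism.

(** The Cartesian product of K_2 and K_3: vertices agreeing in either coordinate
    are adjacent. *)
Definition prism_edge (u v : bool * 'I_3) : bool :=
  (u != v) && ((u.1 == v.1) || (u.2 == v.2)).

Fact prism_edge_sym : symmetric prism_edge.
Proof. by move=> u v; rewrite /prism_edge eq_sym [u.1 == _]eq_sym [u.2 == _]eq_sym. Qed.

Fact prism_edge_irrefl : irreflexive prism_edge.
Proof. by move=> u; rewrite /prism_edge eqxx. Qed.

Definition prism : sgraph := SGraph prism_edge_sym prism_edge_irrefl.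

Implicit Types u v : prism.

Lemma prism_walk2 u v : u != v -> ~~ edge u v -> walk 2 u v.
Proof.
case: u v => [i x] [j y]; rewrite /= /prism_edge => -> /= /norP[ij xy].
apply: (walk_rcons (v := ((i, y) : prism))); last first.
  by rewrite /= /prism_edge xpair_eqE /= (negPf ij) eqxx orbT.
apply: (walk_rcons (walk0 ((i, x) : prism))).
by rewrite /= /prism_edge xpair_eqE /= (negPf xy) eqxx.
Qed.

Lemma prism_dist u v : dist u v <= 2 /\ connect (@edge prism) u v.
Proof.
have [->|uv] := eqVneq u v; first by rewrite dist_self.
have [e|ne] := boolP (edge u v).
  by rewrite connect1 // (leq_trans (dist_edge e)).
have w2 := prism_walk2 uv ne.
by rewrite (walk_connect w2) dist_min.
Qed.

Lemma prism_component v : component v = setT.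
Proof. by apply/setP=> u; rewrite !inE (prism_dist v u).2. Qed.

Lemma prism_ncomp1 v : #|component v| != 1.
Proof. by rewrite prism_component cardsT card_prod card_bool card_ord. Qed.

(** The diameter is 2, so a vertex of value 2 reaches everything and must be
    the only positive one, by [bn_far].  Otherwise all values are at most 1 and
    the positive vertices are independent, so at most one lies in each of the
    two triangles. *)
Lemma prism_bn_weight (f : prism -> nat) :
  broadcast f -> bn_independent f -> weight f <= 2.
Proof.
move=> bf bn.
have f2 v : f v <= 2.
  have := forallP bf v; rewrite (negPf (prism_ncomp1 v)) => /leq_trans; apply.
  by apply/bigmax_leqP=> u _; apply: (prism_dist v u).1.
have [/existsP[v fv2]|no2] := boolP [exists v, f v == 2].
  rewrite /weight (bigD1 v) //= big1 => [|u uv]; first by rewrite addn0 f2.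
  apply/eqP; rewrite -leqn0 leqNgt; apply/negP=> fu.
  have /negP[] : u \notin nbhd f v by apply: bn_far; rewrite ?inE ?(eqP fv2).
  by rewrite inE prism_component inE (eqP fv2) (prism_dist u v).1.
have f1 v : f v <= 1.
  by move: no2 (f2 v); rewrite negb_exists => /forallP/(_ v); lia.
apply: (@leq_trans #|positive f|).
  rewrite -sum1_card [X in _ <= X]big_mkcond; apply: leq_sum => v _.
  by rewrite inE; case: (f v) (f1 v) => [|[]].
rewrite -card_bool -(@card_in_imset _ _ fst).
  by apply/subset_leq_card/subsetP.
move=> u0 v0; move: (u0 : prism) (v0 : prism) => u v pu pv uv1; apply/eqP/negPn/negP=> uv.
have /negP[] := bn_far bn pu pv uv.
have e : edge u v by rewrite /= /prism_edge uv uv1 eqxx.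
by move: pv; rewrite inE [_ \in nbhd _ _]inE prism_component inE;
  apply/leq_trans/dist_edge.
Qed.

Lemma prism_alpha_bn : alpha_bn prism <= 2.
Proof. by apply/bigmax_leqP=> f /andP[]; apply: prism_bn_weight. Qed.

(** Give the value 1 to each vertex of one triangle.  Removing a vertex leaves
    its neighbour in the other triangle undominated. *)
Lemma prism_Gamma_b : 3 <= Gamma_b prism.
Proof.
have b1 : broadcast (fun v : prism => v.1 : nat).
  apply/forallP=> v; rewrite (negPf (prism_ncomp1 v)).
  by apply: leq_trans (ecc_gt0 (prism_ncomp1 v)); case: (v.1).
have [f fE] := broadcast_factor b1.
suff fmin : minimal_dominating f.
  apply: leq_trans (leq_bigmax_cond _ fmin).
  rewrite /weight (eq_bigr _ (fun v _ => fE v)).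
  rewrite -(pair_bigA _ (fun (i : bool) (x : 'I_3) => i : nat)) /=.
  by rewrite big_bool /= !sum_nat_const card_ord.
apply/and3P; split.
- by apply/forallP=> v; have := forallP b1 v; rewrite !fE.
- apply/forallP=> -[i x]; apply/existsP; exists (true, x).
  rewrite [_ \in positive _]inE [_ \in nbhd _ _]inE prism_component inE !fE /=.
  case: i; first by rewrite dist_self.
  by apply: dist_edge; rewrite /= /prism_edge /= eqxx.
apply/forallP=> g; apply/implyP=> /and3P[_ gf /forallP gle].
apply: contra gf => /forallP gdom.
suff gE v : bval g v = v.1 by apply/eqP/ffunP=> v; apply: val_inj; rewrite [LHS]gE -fE.
have := gle v; rewrite fE; case: v => -[] x /=; last by case: (bval g _).
suff g0 : 0 < bval g (true, x) by move=> g1; apply/eqP; rewrite eqn_leq g1.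
(* The vertex (false, x) hears some (true, y) at distance 1, so y = x. *)
have /existsP[[j y] /andP[]] := gdom (false, x).
have := gle (j, y); rewrite [_ \in positive _]inE [_ \in nbhd _ _]inE fE /=.
case: j => /=; last by case: (bval g _).
move=> gy1 gy0 /andP[_ dxy].
case: (@dist_le1 prism (false, x) (true, y)) => [||//|/andP[_ /eqP/= ->//]].
  by rewrite prism_component.
exact: leq_trans dxy gy1.
Qed.

End Prism.

(** * A graph on nine vertices *)

(** The hub [H] is adjacent to all vertices except [A'] and [B'].  The other
    edges form the path A' - A - P - Q - B - B' together with the edges from [R]
    to [P] and [Q]; [T] is a leaf.  Reversing the path is a symmetry. *)
Inductive nine := H | T | R | A | A' | P | B | B' | Q.

Definition nine_index (x : nine) : nat :=
  match x with
  | H => 0 | T => 1 | R => 2 | A => 3 | A' => 4 | P => 5 | B => 6 | B' => 7 | Q => 8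
  end.

Definition nine_enum := [:: H; T; R; A; A'; P; B; B'; Q].

Fact nine_indexK : pcancel nine_index (onth nine_enum).
Proof. by case. Qed.

HB.instance Definition _ := Countable.copy nine (pcan_type nine_indexK).

Fact nine_enumP : Finite.axiom nine_enum.
Proof. by case. Qed.

HB.instance Definition _ := isFinite.Build nine nine_enumP.

Definition nine_dist (x y : nine) : nat :=
  nth 0
    match x with
    (*          H  T  R  A  A' P  B  B' Q *)
    | H  => [:: 0; 1; 1; 1; 2; 1; 1; 2; 1]
    | T  => [:: 1; 0; 2; 2; 3; 2; 2; 3; 2]
    | R  => [:: 1; 2; 0; 2; 3; 1; 2; 3; 1]
    | A  => [:: 1; 2; 2; 0; 1; 1; 2; 3; 2]
    | A' => [:: 2; 3; 3; 1; 0; 2; 3; 4; 3]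
    | P  => [:: 1; 2; 1; 1; 2; 0; 2; 3; 1]
    | B  => [:: 1; 2; 2; 2; 3; 2; 0; 1; 1]
    | B' => [:: 2; 3; 3; 3; 4; 3; 1; 0; 2]
    | Q  => [:: 1; 2; 1; 2; 3; 1; 1; 2; 0]
    end (nine_index y).

Definition nine_nbrs (x : nine) : seq nine :=
  match x with
  | H => [:: T; R; A; P; B; Q]
  | T => [:: H]
  | R => [:: H; P; Q]
  | A => [:: H; A'; P]
  | A' => [:: A]
  | P => [:: H; R; A; Q]
  | B => [:: H; B'; Q]
  | B' => [:: B]
  | Q => [:: H; R; P; B]
  end.

Definition nine_edge : rel nine := fun x y => y \in nine_nbrs x.

Fact nine_edge_sym : symmetric nine_edge.
Proof. by do 2!case. Qed.

Fact nine_edge_irrefl : irreflexive nine_edge.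
Proof. by case. Qed.

Definition nine_graph : sgraph := SGraph nine_edge_sym nine_edge_irrefl.

Fact nine_dist0 x y : (nine_dist x y == 0) = (x == y).
Proof. by case: x y => [] []. Qed.

Fact nine_dist_lip x y z : nine_edge y z -> nine_dist x z <= (nine_dist x y).+1.
Proof. by case: x y z => [] [] []. Qed.

Fact nine_dist_pred x y :
  0 < nine_dist x y -> exists2 z, nine_edge z y & nine_dist x y = (nine_dist x z).+1.
Proof.
move=> xy.
have /hasP[z _ /andP[zy /eqP dz]] :
    has (fun z => nine_edge z y && (nine_dist x y == (nine_dist x z).+1)) nine_enum.
  by case: x y xy => [] [].
by exists z.
Qed.

Lemma nine_distE (x y : nine_graph) : dist x y = nine_dist x y.
Proof.
exact: (@table_dist nine_graph _ nine_dist0 nine_dist_lip nine_dist_pred).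
Qed.

Lemma nine_component (x : nine_graph) : component x = setT.
Proof. exact: (@table_component nine_graph _ nine_dist0 nine_dist_pred). Qed.

Lemma nine_nbhd (f : nine_graph -> nat) x y :
  (y \in nbhd f x) = (nine_dist y x <= f x).
Proof. by rewrite inE nine_component inE nine_distE. Qed.

Lemma sum_nine (F : nine -> nat) :
  \sum_x F x = F H + F T + F R + F A + F A' + F P + F B + F B' + F Q.
Proof.
rewrite (bigD1 H) //= (bigD1 T) //= (bigD1 R) //= (bigD1 A) //= (bigD1 A') //=.
rewrite (bigD1 P) //= (bigD1 B) //= (bigD1 B') //= (bigD1 Q) //= big_pred0; last by case.
by lia.
Qed.

(** * Minimal dominating broadcasts of the nine-vertex graph *)

Definition nine_ecc (x : nine) : nat :=
  match x with H => 2 | A' | B' => 4 | _ => 3 end.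

Fact nine_dist_ecc z x : nine_dist z x <= nine_ecc x.
Proof. by case: x z => [] []. Qed.

Ltac table := rewrite /nine_dist /=; lia.

(* The vertex x reaches all vertices outside s, and a vertex with a private
   vertex in s has value at most k, too little for a total above 4. *)
Tactic Notation "sparse" constr(light) constr(x) constr(k) constr(s) :=
  apply (light x k s);
    [lia | rewrite /=; lia | by case=> //; table | by do 2!case=> //; table].

(** The hypotheses are the consequences of minimal domination that the bound
    rests on, with distances read in the table: [dom] is domination, [priv]
    combines [minimal_irredundant] with [private_dist] and [private_other], and
    [uncov] is [weight_le_uncovered]. *)
Section UpperBound.
Variable f : nine -> nat.
Hypothesis dom : forall z, exists2 x, 0 < f x & nine_dist z x <= f x.
Hypothesis priv : forall x, 0 < f x -> exists2 z, f x = maxn 1 (nine_dist z x)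
  & forall w, w != x -> 0 < f w -> f w < nine_dist z w.
Hypothesis uncov : forall x k s, 0 < f x ->
  (forall z, f x < nine_dist z x -> z \in s) ->
  (forall y z, y != x -> 0 < f y -> f y = maxn 1 (nine_dist z y) ->
     z \in s -> f y <= k) ->
  \sum_x f x <= f x + k * size s.

(** Suppose that the weight exceeds 4.  A vertex whose broadcast reaches all or
    almost all others leaves room for few private vertices, which by [uncov]
    keeps the weight at most 4; this lowers the possible values step by step,
    each step using the bounds already found.  What remains are values 0 and 1
    with [f H = 0], apart from the value 2 at [A'] and [B'].  A value 2 at [A']
    would need [P] as a private vertex, as [H] hears the leaf [T].  But [P]
    hears every vertex that is still able to dominate [R].  The remaining sets
    have at most 4 elements, by comparing neighbourhoods. *)
Lemma nine_weight_le4 : \sum_x f x <= 4.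
Proof.
rewrite leqNgt; apply/negP=> big.
have light x k s : 0 < f x -> f x + k * size s <= 4 ->
    (forall z, f x < nine_dist z x -> z \in s) ->
    (forall y z, y != x -> 0 < f y -> f y = maxn 1 (nine_dist z y) ->
     z \in s -> f y <= k) -> False.
  move=> fx le4 xs sk; move: big; rewrite ltnNge => /negP[].
  exact: leq_trans (uncov fx xs sk) le4.
have ecc x : f x < nine_ecc x.
  have [->|fx] := posnP (f x); first by case: x.
  rewrite ltnNge; apply/negP=> full.
  have f4 : f x <= 4.
    have [z -> _] := priv fx; apply: leq_trans (_ : nine_ecc x <= 4).
      by rewrite geq_max nine_dist_ecc andbT; case: (x).
    by case: (x).
  apply: (@light x 0 [::]) => //; first by rewrite muln0 addn0.
  by move=> z; rewrite ltnNge (leq_trans (nine_dist_ecc z x) full).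
have eccH : f H < 2 := ecc H.
have [eccT eccR eccA] : [/\ f T < 3, f R < 3 & f A < 3] := And3 (ecc T) (ecc R) (ecc A).
have [eccP eccB eccQ] : [/\ f P < 3, f B < 3 & f Q < 3] := And3 (ecc P) (ecc B) (ecc Q).
have [eccA' eccB'] : f A' < 4 /\ f B' < 4 := conj (ecc A') (ecc B').
(* With value 2 only the far leaf is missed, and the vertices of value less
   than their eccentricity that have it as a private vertex have value at
   most 2. *)
have A1 : f A < 2.
  rewrite ltnNge; apply/negP=> ge.
  by sparse light A 2 [:: B'].
have P1 : f P < 2.
  rewrite ltnNge; apply/negP=> ge.
  by sparse light P 2 [:: B'].
have B1 : f B < 2.
  rewrite ltnNge; apply/negP=> ge.
  by sparse light B 2 [:: A'].
have Q1 : f Q < 2.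
  rewrite ltnNge; apply/negP=> ge.
  by sparse light Q 2 [:: A'].
(* Since A, P, B and Q no longer have value 2, a private vertex A' or B' now
   forces the value 1. *)
have A'2 : f A' < 3.
  rewrite ltnNge; apply/negP=> ge.
  by sparse light A' 1 [:: B'].
have B'2 : f B' < 3.
  rewrite ltnNge; apply/negP=> ge.
  by sparse light B' 1 [:: A'].
have R1 : f R < 2.
  rewrite ltnNge; apply/negP=> ge.
  by sparse light R 1 [:: A'; B'].
have T1 : f T < 2.
  rewrite ltnNge; apply/negP=> ge.
  by sparse light T 1 [:: A'; B'].
have H0 : f H = 0.
  have [//|ge] := posnP (f H).
  exfalso; sparse light H 1 [:: A'; B'].
(* The leaf T has no other possible dominator. *)
have fT : f T = 1 by have [[]] := dom T; table.
have A'1 : f A' < 2.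
  rewrite ltnNge; apply/negP=> ge.
  have [|z fz zpriv] := @priv A'; first lia.
  have [x] := dom R.
  have := zpriv T isT; have := zpriv R isT; have := zpriv P isT; have := zpriv Q isT.
  by case: z fz {zpriv} => //; case: x; table.
have B'1 : f B' < 2.
  rewrite ltnNge; apply/negP=> ge.
  have [|z fz zpriv] := @priv B'; first lia.
  have [x] := dom R.
  have := zpriv T isT; have := zpriv R isT; have := zpriv P isT; have := zpriv Q isT.
  by case: z fz {zpriv} => //; case: x; table.
(* If the closed neighbourhood of x is contained in that of y, a positive y
   leaves no private vertex to x of value 1. *)
have disj x y : f x <= 1 -> x != y ->
    (forall z, nine_dist z x <= 1 -> nine_dist z y <= 1) -> f x = 0 \/ f y = 0.
  move=> x1 neq xy; have [|fx] := posnP (f x); first by left.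
  have [|fy] := posnP (f y); first by right.
  have [z fz /(_ y)] := priv fx; rewrite eq_sym neq => /(_ isT fy) lt.
  have := xy z; lia.
have AA' : f A + f A' <= 1.
  by case: (@disj A' A) => //; [case | lia | lia].
have BB' : f B + f B' <= 1.
  by case: (@disj B' B) => //; [case | lia | lia].
have RP : f R + f P <= 1.
  by case: (@disj R P) => //; [case | lia | lia].
have RQ : f R + f Q <= 1.
  by case: (@disj R Q) => //; [case | lia | lia].
(* If P and Q are both positive, the private vertex of P can only be A, which
   then hears neither A nor A'. *)
have PQ : f P + f Q + f A + f A' <= 2.
  have [|p] := posnP (f P); first lia.
  have [|q] := posnP (f Q); first lia.
  have [z fz zpriv] := priv p.
  have := zpriv Q isT q; have := zpriv A isT; have := zpriv A' isT.
  by case: z fz {zpriv} => //; table.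
by move: big; rewrite sum_nine; lia.
Qed.
End UpperBound.

Lemma nine_boundary (f : nine_graph -> nat) x y :
  (y \in boundary f x) = (nine_dist y x == f x).
Proof. by rewrite inE nine_component inE nine_distE. Qed.

Lemma nine_dominatedE (f : nine_graph -> nat) z :
  dominated f z = has (fun x => (0 < f x) && (nine_dist z x <= f x)) nine_enum.
Proof.
apply/existsP/hasP=> [[x]|[x _ fx]].
  by rewrite inE nine_nbhd => fx; exists x => //; case: (x).
by exists x; rewrite inE nine_nbhd.
Qed.

Lemma nine_ncomp1 (x : nine_graph) : #|component x| != 1.
Proof. by rewrite nine_component cardsT cardT enumT unlock. Qed.

Lemma nine_minimal_weight (f : bfun nine_graph) :
  minimal_dominating f -> weight f <= 4.
Proof.
move=> fmin; have irr := minimal_irredundant fmin.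
case/and3P: fmin => _ /forallP fdom _.
apply: (@nine_weight_le4 (bval f)).
- move=> z; have := fdom z; rewrite nine_dominatedE => /hasP[x _ /andP[]].
  by exists x.
- move=> x fx; have px : x \in positive f by rewrite inE.
  have /implyP/(_ px)/set0Pn[z zx] := forallP irr x.
  exists z; first by rewrite (private_dist px zx) nine_distE.
  move=> w wx fw; have := @private_other nine_graph f x w z zx _ wx.
  by rewrite inE nine_nbhd -ltnNge; apply.
- move=> x k s fx xs sk; apply: (weight_le_uncovered irr) => //.
  + by rewrite inE.
  + by move=> z; rewrite nine_nbhd -ltnNge; apply: xs.
  move=> y z yx py zy zs; apply: (sk y z) => //; first by move: py; rewrite inE.
  by rewrite (private_dist py zy) nine_distE.
Qed.

(** * A heavier bnr-independent broadcast *)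

(** The balls around [A'] and [B'] meet only in [H], at distance 2 from both and
    at distance 1 from [T].  The private vertices are [P], [Q] and [T]; the
    vertex [R] is undominated, and dominating it would cost [A'] or [B'] its
    private vertex. *)
Definition nine_bnr (x : nine_graph) : nat :=
  match x with T => 1 | A' | B' => 2 | _ => 0 end.

Lemma nine_bnr_broadcast : broadcast nine_bnr.
Proof.
apply/forallP=> x; rewrite (negPf (nine_ncomp1 x)).
have reach y : nine_dist x y <= ecc x.
  by rewrite -nine_distE; apply: leq_bigmax_cond; rewrite nine_component inE.
by move: (reach H) (reach A') (reach B'); case: (x); rewrite /nine_dist /=; lia.
Qed.

Lemma nine_bnr_independent f : f =1 nine_bnr -> bnr_independent f.
Proof.
move=> fE; apply/andP; split.
  apply/forallP=> u; apply/implyP=> pu; apply/forallP=> v; apply/implyP=> pv.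
  apply/implyP=> uv; apply/subsetP=> x.
  rewrite !in_setI !nine_nbhd !nine_boundary.
  move: pu pv; rewrite !inE !fE.
  by case: u v uv x => [] [] // _ [].
apply/forallP=> v; apply/implyP; rewrite inE => fv; apply/set0Pn.
exists (match v with A' => P | B' => Q | _ => T end).
rewrite inE nine_nbhd nine_dominatedE /decrease; move: fv.
by case: v; rewrite /= !fE.
Qed.

Lemma nine_Gamma_b : Gamma_b nine_graph <= 4.
Proof. by apply/bigmax_leqP=> f; apply: nine_minimal_weight. Qed.

Lemma nine_alpha_bnr : 5 <= alpha_bnr nine_graph.
Proof.
have [f fE] := broadcast_factor nine_bnr_broadcast.
have <- : weight f = 5 by rewrite /weight (eq_bigr _ (fun x _ => fE x)) sum_nine.
apply: (@leq_bigmax_cond _ _ (fun h : bfun nine_graph => weight h)).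
rewrite nine_bnr_independent // andbT.
by apply/forallP=> x; have := forallP nine_bnr_broadcast x; rewrite !fE.
Qed.

(** * Incomparability *)

Theorem mainTheorem1 :
  (exists G1 : sgraph, Gamma_b G1 < alpha_bnr G1) /\
  (exists G2 : sgraph, alpha_bnr G2 < Gamma_b G2) /\
  (exists G3 : sgraph, Gamma_b G3 < alpha_bn G3) /\
  (exists G4 : sgraph, alpha_bn G4 < Gamma_b G4).
Proof.
have nine_lt := leq_ltn_trans nine_Gamma_b nine_alpha_bnr.
have prism_lt := leq_ltn_trans prism_alpha_bn prism_Gamma_b.
split; first by exists nine_graph.
split; first by exists prism; apply: leq_ltn_trans (alpha_bnr_le_bn _) prism_lt.
split; last by exists prism.
by exists nine_graph; apply: leq_trans nine_lt (alpha_bnr_le_bn _).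
Qed.
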